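(* Let $n\geq 3$ be an odd integer, and let $\lambda, X, Y, U, T$ be indeterminates. Then the assignment $\lambda\mapsto\lambda$, $X\mapsto U$, $Y\mapsto U^{(n+1)/2}\,T$ defines a well-defined surjective homomorphism of $\mathbb{Z}$-algebras $$\frac{\mathbb{Z}[\lambda][X,Y]}{\left(Y^2-X(X+1)(X+\lambda)\right)}\longrightarrow \frac{\mathbb{Z}[\lambda,U,T]}{\left(U^n-U-1,\;T^2-(U+\lambda)\right)}.$$
   Context: In the target ring, $T$ plays the role of a square root of $U+\lambda$, so the image of $Y$ may be written $U^{(n+1)/2}\sqrt{U+\lambda}$. *)

(* Defs.v *)
From HB Require Import structures.
From mathcomp Require Import all_boot all_order all_algebra.
From mathcomp Require Import boolp mpoly.

Set Implicit Arguments.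
Unset Strict Implicit.
Unset Printing Implicit Defensive.

Import GRing.Theory.
Local Open Scope ring_scope.
Local Open Scope quotient_scope.

Section GeneratedIdeal.
Variables (R : comNzRingType) (gs : seq R).

Definition ideal_gen : {pred R} :=
  fun x => `[< exists c : nat -> R, x = \sum_(i < size gs) c i * gs`_i >].

Lemma ideal_genP x :
  reflect (exists c : nat -> R, x = \sum_(i < size gs) c i * gs`_i)
          (x \in ideal_gen).
Proof. exact: asboolP. Qed.

Lemma ideal_gen_zmod_closed : zmod_closed ideal_gen.
Proof.
split=> [|x y /ideal_genP[c ->] /ideal_genP[d ->]]; apply/ideal_genP.
  by exists (fun=> 0); rewrite big1 // => i _; rewrite mul0r.
exists (fun i => c i - d i); rewrite -sumrB.
by apply: eq_bigr => i _; rewrite mulrBl.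
Qed.

HB.instance Definition _ :=
  GRing.isZmodClosed.Build R ideal_gen ideal_gen_zmod_closed.

Lemma ideal_genMl a x : x \in ideal_gen -> a * x \in ideal_gen.
Proof.
move=> /ideal_genP[c ->]; apply/ideal_genP; exists (fun i => a * c i).
by rewrite mulr_sumr; apply: eq_bigr => i _; rewrite mulrA.
Qed.

(* The library puts a multiplication on {ideal_quot I} only when I is proper;
   here it is defined for every ideal, so that the quotient may be the zero
   ring.  The additive structure is the one of the library. *)
Definition quot_ring := @Quotient.quot R ideal_gen.

HB.instance Definition _ := GRing.Zmodule.on quot_ring.
HB.instance Definition _ :=
  ZmodQuotient.copy quot_ring (@Quotient.quot R ideal_gen).

Definition quot_map (x : R) : quot_ring := \pi x.

Lemma quot_map_surj (x : quot_ring) : exists y, x = quot_map y.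
Proof. by exists (repr x); rewrite /quot_map reprK. Qed.

Lemma quot_map_eqE x y : (quot_map x == quot_map y) = (x - y \in ideal_gen).
Proof. by rewrite Quotient.idealrBE. Qed.

Lemma quot_map_is_zmod_morphism : zmod_morphism quot_map.
Proof. by move=> x y; rewrite /quot_map raddfB. Qed.

HB.instance Definition _ := GRing.isZmodMorphism.Build R quot_ring quot_map
  quot_map_is_zmod_morphism.

Definition quot_one : quot_ring := quot_map 1.
Definition quot_mul (x y : quot_ring) : quot_ring :=
  quot_map (repr x * repr y).

Lemma quot_map_mul x y : quot_mul (quot_map x) (quot_map y) = quot_map (x * y).
Proof.
have reprB z : repr (quot_map z) - z \in ideal_gen.
  by rewrite -quot_map_eqE /quot_map reprK.
apply/eqP; rewrite quot_map_eqE.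
set x' := repr _; set y' := repr _.
have -> : x' * y' - x * y = x' * (y' - y) + y * (x' - x).
  by rewrite !mulrBr addrA (mulrC y x') subrK (mulrC y x).
by apply: rpredD; apply: ideal_genMl; apply: reprB.
Qed.

Lemma quot_mulA : associative quot_mul.
Proof.
move=> x y z; have [[x' ->] [y' ->] [z' ->]] :=
  And3 (quot_map_surj x) (quot_map_surj y) (quot_map_surj z).
rewrite (quot_map_mul y' z') (quot_map_mul x' y').
by rewrite (quot_map_mul x' (y' * z')) (quot_map_mul (x' * y') z') mulrA.
Qed.

Lemma quot_mulC : commutative quot_mul.
Proof. by move=> x y; rewrite /quot_mul mulrC. Qed.

Lemma quot_mul1 : left_id quot_one quot_mul.
Proof.
by move=> x; have [y ->] := quot_map_surj x; rewrite quot_map_mul mul1r.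
Qed.

Lemma quot_mulDl : left_distributive quot_mul +%R.
Proof.
move=> x y z; have [[x' ->] [y' ->] [z' ->]] :=
  And3 (quot_map_surj x) (quot_map_surj y) (quot_map_surj z).
rewrite -raddfD (quot_map_mul (x' + y') z') mulrDl raddfD.
by rewrite (quot_map_mul x' z') (quot_map_mul y' z').
Qed.

HB.instance Definition _ := GRing.Zmodule_isComPzRing.Build quot_ring
  quot_mulA quot_mulC quot_mul1 quot_mulDl.

Lemma quot_map_is_monoid_morphism : monoid_morphism quot_map.
Proof. by split=> // x y; rewrite -quot_map_mul. Qed.

HB.instance Definition _ := GRing.isMonoidMorphism.Build R quot_ring quot_map
  quot_map_is_monoid_morphism.

End GeneratedIdeal.

(* Z[lambda][X, Y]: lambda is the variable of the coefficient ring
   {poly int}, embedded as a constant polynomial. *)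
Definition src_lambda : {mpoly {poly int}[2]} := ('X : {poly int})%:MP.
Definition src_X : {mpoly {poly int}[2]} := 'X_(Ordinal (isT : (0 < 2)%N)).
Definition src_Y : {mpoly {poly int}[2]} := 'X_(Ordinal (isT : (1 < 2)%N)).

(* Z[lambda, U, T] *)
Definition tgt_lambda : {mpoly int[3]} := 'X_(Ordinal (isT : (0 < 3)%N)).
Definition tgt_U : {mpoly int[3]} := 'X_(Ordinal (isT : (1 < 3)%N)).
Definition tgt_T : {mpoly int[3]} := 'X_(Ordinal (isT : (2 < 3)%N)).

Definition src_rels : seq {mpoly {poly int}[2]} :=
  [:: src_Y ^+ 2 - src_X * (src_X + 1) * (src_X + src_lambda)].

Definition tgt_rels (n : nat) : seq {mpoly int[3]} :=
  [:: tgt_U ^+ n - tgt_U - 1; tgt_T ^+ 2 - (tgt_U + tgt_lambda)].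

Notation src_ring := (quot_ring src_rels).
Notation tgt_ring n := (quot_ring (tgt_rels n)).

(* For odd n, (n.+1)./2 is exactly (n + 1) / 2. *)
Definition sends_generators (n : nat) (f : src_ring -> tgt_ring n) : Prop :=
  [/\ f (quot_map src_rels src_lambda) = quot_map (tgt_rels n) tgt_lambda,
      f (quot_map src_rels src_X) = quot_map (tgt_rels n) tgt_U
    & f (quot_map src_rels src_Y) =
        quot_map (tgt_rels n) (tgt_U ^+ (n.+1)./2 * tgt_T)].

(* Main.v *)
(* The relation U^n = U + 1 gives U^(n+1) = U (U + 1), so the images satisfy
   (U^((n+1)/2) T)^2 = U (U + 1) (U + lambda) and the homomorphism exists.  The
   same relation reads U (U^(n-1) - 1) = 1: U is invertible in the target, with
   inverse in the subring generated by U, so T = (U^(n-1) - 1)^((n+1)/2) * Y is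
   in the image. *)
Require Import Defs.
From HB Require Import structures.
From mathcomp Require Import all_boot all_order all_algebra.
From mathcomp Require Import boolp mpoly.

Import GRing.Theory.
Local Open Scope ring_scope.

Section QuotientLift.
Variables (R : comNzRingType) (gs : seq R) (S : comPzRingType).
Variable phi : {rmorphism R -> S}.

Lemma mem_ideal_gen (x : R) : x \in gs -> x \in ideal_gen gs.
Proof.
(* The coefficients are the indicator of the first position of [x] in [gs], so repeated generators
   cause no trouble. *)
move=> x_gs; apply/ideal_genP; exists (fun i => (i == index x gs)%:R).
have lt_x : (index x gs < size gs)%N by rewrite index_mem.
rewrite (bigD1 (Ordinal lt_x)) //= eqxx mul1r nth_index // big1 ?addr0 // => i.
by rewrite -val_eqE /= => /negPf->; rewrite mul0r.
Qed.

Lemma rmorph_ideal_gen x :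
  {in gs, forall g, phi g = 0} -> x \in ideal_gen gs -> phi x = 0.
Proof.
move=> phi0 /ideal_genP[c ->]; rewrite rmorph_sum big1 // => i _.
by rewrite rmorphM [phi gs`_i]phi0 ?mulr0 ?mem_nth.
Qed.

(** Universal property of the quotient: [phi] is applied to a chosen representative, and two
    representatives of a class differ by an element of the ideal, which [phi] kills. *)
Lemma quot_lift : {in gs, forall g, phi g = 0} ->
  exists f : {rmorphism quot_ring gs -> S},
    forall x, f (quot_map gs x) = phi x.
Proof.
move=> phi0; pose f (x : quot_ring gs) := phi (repr x).
have fE x : f (quot_map gs x) = phi x.
  apply/eqP; rewrite -subr_eq0 -rmorphB; apply/eqP/rmorph_ideal_gen => //.
  by rewrite -quot_map_eqE /quot_map generic_quotient.reprK.
have fB : zmod_morphism f.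
  move=> x y; have [[x' ->] [y' ->]] := (quot_map_surj x, quot_map_surj y).
  by rewrite -rmorphB !fE rmorphB.
have fM : monoid_morphism f.
  split=> [|x y]; first by rewrite -(rmorph1 (quot_map gs)) fE rmorph1.
  have [[x' ->] [y' ->]] := (quot_map_surj x, quot_map_surj y).
  by rewrite -rmorphM !fE rmorphM.
pose fBM := GRing.isZmodMorphism.Build _ _ f fB.
pose fMM := GRing.isMonoidMorphism.Build _ _ f fM.
pose F : {rmorphism quot_ring gs -> S} := HB.pack f fBM fMM.
by exists F.
Qed.

End QuotientLift.

Lemma rmorph_mpoly_ext k (R : nzRingType) (S : pzRingType)
    (f g : {rmorphism {mpoly R[k]} -> S}) :
    (forall c, f c%:MP = g c%:MP) -> (forall i, f 'X_i = g 'X_i) -> f =1 g.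
Proof.
move=> eqC eqX p; rewrite (mpolyE p) !rmorph_sum; apply: eq_bigr => m _.
rewrite -mul_mpolyC !rmorphM eqC mpolyXE_id !rmorph_prod; congr (_ * _).
by apply: eq_bigr => i _; rewrite !rmorphXn eqX.
Qed.

(** Integer constants have forced images, so only the value at ['X] is free. *)
Lemma rmorph_polyint_ext (S : pzRingType) (f g : {rmorphism {poly int} -> S}) :
  f 'X = g 'X -> f =1 g.
Proof.
move=> eqX; elim/poly_ind => [|p c IHp]; first by rewrite !rmorph0.
by rewrite !rmorphD !rmorphM IHp eqX -[c]intz !rmorph_int.
Qed.

Section Generators.
Variable S : pzRingType.

Lemma rmorph_src_ext (f g : {rmorphism {mpoly {poly int}[2]} -> S}) :
    f src_lambda = g src_lambda -> f src_X = g src_X -> f src_Y = g src_Y ->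
  f =1 g.
Proof.
move=> eql eqX eqY; apply: rmorph_mpoly_ext => [|i].
  exact: (@rmorph_polyint_ext S (f \o @mpolyC 2 _) (g \o @mpolyC 2 _) eql).
by case: i => [[|[|i]] lt_i] //.
Qed.

Lemma rmorph_tgt_ext (f g : {rmorphism {mpoly int[3]} -> S}) :
    f tgt_lambda = g tgt_lambda -> f tgt_U = g tgt_U -> f tgt_T = g tgt_T ->
  f =1 g.
Proof.
move=> eql eqU eqT; apply: rmorph_mpoly_ext => [c|i].
  by rewrite -[c]intz !rmorph_int.
by case: i => [[|[|[|i]]] lt_i] //.
Qed.

End Generators.

(** Evaluation in two stages: Horner evaluation at [l] on the coefficients, then [x] and [y] for the
    two variables. It is meant for polynomial rings as targets; the quotient, not known to be
    nonzero, is reached by composing with the projection. *)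
Lemma src_eval (S : comNzRingType) (l x y : S) :
  exists h : {rmorphism {mpoly {poly int}[2]} -> S},
    [/\ h src_lambda = l, h src_X = x & h src_Y = y].
Proof.
pose c : {rmorphism {poly int} -> S} :=
  horner_morph (fun a : int => mulrC l (a%:~R)).
exists (mmap c (fun i : 'I_2 => nth 0 [:: x; y] i)).
by rewrite /= mmapC !mmapX !mmap1U /= /c /= horner_morphX.
Qed.

Lemma tgt_eval (S : comNzRingType) (l u t : S) :
  exists h : {rmorphism {mpoly int[3]} -> S},
    [/\ h tgt_lambda = l, h tgt_U = u & h tgt_T = t].
Proof.
exists (mmap (intmul 1) (fun i : 'I_3 => nth 0 [:: l; u; t] i)).
by rewrite /= !mmapX !mmap1U.
Qed.

Section Target.
Variable n : nat.
Local Notation q := (quot_map (tgt_rels n)).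

Lemma tgt_relU : q tgt_U ^+ n = q tgt_U + 1.
Proof.
rewrite -rmorphXn -(rmorph1 q) -rmorphD; apply/eqP; rewrite quot_map_eqE.
by rewrite opprD addrA mem_ideal_gen // inE eqxx.
Qed.

Lemma tgt_relT : q tgt_T ^+ 2 = q tgt_U + q tgt_lambda.
Proof.
rewrite -rmorphXn -rmorphD; apply/eqP; rewrite quot_map_eqE.
by rewrite mem_ideal_gen // !inE eqxx orbT.
Qed.

Lemma tgt_U_inv : (0 < n)%N -> (q tgt_U ^+ n.-1 - 1) * q tgt_U = 1.
Proof.
by move=> n_gt0; rewrite mulrBl mul1r -exprSr prednK // tgt_relU addrC addKr.
Qed.

Lemma tgt_Y_sqr : odd n ->
  q (tgt_U ^+ (n.+1)./2 * tgt_T) ^+ 2 =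
  q tgt_U * (q tgt_U + 1) * (q tgt_U + q tgt_lambda).
Proof.
(* As [n.+1] is even, doubling its half gives back [n.+1] exactly. *)
move=> n_odd; rewrite rmorphM rmorphXn exprMn -exprM muln2 even_halfK /= ?n_odd //.
by rewrite exprS tgt_relU tgt_relT.
Qed.

End Target.

(* A homomorphism of Z-algebras is the same as a ring homomorphism. *)
Theorem theorem4p1 (n : nat) (n_ge3 : (3 <= n)%N) (n_odd : odd n) :
  exists f : {rmorphism src_ring -> tgt_ring n},
    [/\ sends_generators f,
        forall g : {rmorphism src_ring -> tgt_ring n},
          sends_generators g -> g =1 f
      & forall b : tgt_ring n, exists a : src_ring, f a = b].
Proof.
have [h [hl hX hY]] :=
  src_eval _ tgt_lambda tgt_U (tgt_U ^+ (n.+1)./2 * tgt_T).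
pose q := quot_map (tgt_rels n); pose p := quot_map src_rels.
have [f fE] : exists f : {rmorphism src_ring -> tgt_ring n},
    forall x, f (p x) = (q \o h) x.
  apply: quot_lift => _ /[!inE] /eqP-> /=.
  rewrite !(rmorphB, rmorphM, rmorphD, rmorphXn, rmorph1) hl hX hY.
  by rewrite -[X in X - _]expr2 tgt_Y_sqr // subrr.
exists f; split.
- by split; rewrite fE /= ?hl ?hX ?hY.
(* Uniqueness: precomposed with the projection [p], both maps are determined by their values at the
   three generators. *)
- move=> g [gl gX gY] x; have [y ->] := quot_map_surj x.
  by apply: (@rmorph_src_ext _ (g \o p) (f \o p));
    rewrite /= fE /= ?hl ?hX ?hY.
move=> b; have [y ->] := quot_map_surj b.
(* The map [s] lifts the target polynomials to source polynomials. Modulo the target relations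
   [h \o s] fixes each generator, hence every polynomial, so [p (s y)] is a preimage. For [T], the
   power of the inverse of [U] cancels the factor carried by the image of [Y]. *)
have [s [sl sU sT]] :=
  tgt_eval _ src_lambda src_X ((src_X ^+ n.-1 - 1) ^+ (n.+1)./2 * src_Y).
exists (p (s y)); rewrite fE.
apply: (@rmorph_tgt_ext _ (q \o h \o s) q) => /=;
  rewrite ?sl ?sU ?sT ?hl ?hX //.
rewrite !(rmorphM, rmorphXn, rmorphB, rmorph1) hX hY !(rmorphM, rmorphXn).
by rewrite mulrA -exprMn tgt_U_inv ?expr1n ?mul1r // odd_gt0.
Qed.
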